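(* Let $X$ be a real Banach space. If the bidual $X^{**}$ has property $( * )$, then $X$ has property $( * )$.
   Context: For a real Banach space $X$, $B_X$ is the closed unit ball, $S_X$ the unit sphere, $X^*$ the dual. For $x^*\in S_{X^*}$ and $\varepsilon>0$ put $S(x^*,\varepsilon)=\{x\in B_X: x^*(x)>1-\varepsilon\}$, and $-S(x^*,\varepsilon)=\{-x: x\in S(x^*,\varepsilon)\}$. For $A\subseteq X$, $\operatorname{d}(x,A)$ is the distance from $x$ to $A$. A real Banach space $X$ has property $( * )$ if for every $\varepsilon>0$ and all $x,y_1,y_2\in S_X$ there exists $x^*\in S_{X^*}$ such that $x\in S(x^*,\varepsilon)$ and $\operatorname{d}(y_i,S(x^*,\varepsilon))+\operatorname{d}(y_i,-S(x^*,\varepsilon))<2+\varepsilon$ for $i=1,2$. *)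

(* Defs.v *)
From HB Require Import structures.
From mathcomp Require Import all_boot all_order all_algebra.
From mathcomp Require Import all_classical all_reals all_analysis.

Set Implicit Arguments.
Unset Strict Implicit.
Unset Printing Implicit Defensive.

Import Order.TTheory GRing.Theory Num.Theory.
Import numFieldNormedType.Exports.

Local Open Scope classical_set_scope.
Local Open Scope ring_scope.

(* The topological dual of X, as a Banach space for the operator norm. The
   library provides no bundled type of continuous linear forms. The codomain
   is R^o, i.e. R seen as a normed module over itself. *)
Section DualSpace.
Context {R : realType} {X : normedModType R}.

Definition continuous_linear_form : {pred (X -> R^o)} :=
  mem [set f : X -> R^o | linear f /\ continuous f].

Record dual : Type := Dual {
  dual_fun :> X -> R^o ;
  dual_funP : dual_fun \in continuous_linear_form }.

HB.instance Definition _ := [isSub for dual_fun].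
HB.instance Definition _ := [Choice of dual by <:].

Lemma continuous_linear_form_submod_closed :
  submod_closed continuous_linear_form.
Proof.
split.
  rewrite inE; split; last exact: cst_continuous.
  by move=> a x y /=; rewrite -[0 x]/(0 : R^o) -[0 y]/(0 : R^o) scaler0 addr0.
move=> a f g; rewrite !inE => -[lf cf] [lg cg]; split.
  move=> b x y; rewrite -![(a *: f + g) _]/(a *: f _ + g _) lf lg.
  by rewrite !scalerDr !scalerA (mulrC a b) addrACA.
by move=> x; apply: cvgD; [apply: cvgZl_tmp; exact: cf|exact: cg].
Qed.

HB.instance Definition _ := GRing.isSubmodClosed.Build _ _
  continuous_linear_form continuous_linear_form_submod_closed.
HB.instance Definition _ := [SubChoice_isSubLmodule of dual by <:].

Lemma dual_linear (f : dual) : linear f.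
Proof. by have := dual_funP f; rewrite inE => -[]. Qed.

Lemma dual_continuous (f : dual) : continuous f.
Proof. by have := dual_funP f; rewrite inE => -[]. Qed.

HB.instance Definition _ (f : dual) :=
  GRing.isLinear.Build R X R^o *:%R (dual_fun f) (@dual_linear f).

Definition dual_norm (f : dual) : R :=
  sup [set `|f x| | x in [set x : X | `|x| <= 1]].

Lemma dual_norm_has_sup (f : dual) :
  has_sup [set `|f x| | x in [set x : X | `|x| <= 1]].
Proof.
split; first by exists `|f 0|, 0 => //=; rewrite normr0 ler01.
have /linear_bounded_continuous/bounded_funP/(_ 1)[M fM] :=
  @dual_continuous f.
by exists M => _ [x /= x1 <-]; exact: fM.
Qed.

Lemma le_dual_norm (f : dual) (x : X) : `|f x| <= dual_norm f * `|x|.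
Proof.
have [->|x0] := eqVneq x 0; first by rewrite raddf0 !normr0 mulr0.
rewrite -ler_pdivrMr ?normr_gt0//.
apply: ub_le_sup; first by have [] := dual_norm_has_sup f.
exists (`|x|^-1 *: x) => /=.
  by rewrite normrZ normfV normr_id mulVf// normr_eq0.
by rewrite linearZ/= normrZ normfV normr_id mulrC.
Qed.

Lemma dual_norm_le (f : dual) (M : R) :
  (forall x, `|x| <= 1 -> `|f x| <= M) -> dual_norm f <= M.
Proof.
move=> fM; apply: ge_sup; first by have [] := dual_norm_has_sup f.
by move=> _ [x /= x1 <-]; exact: fM.
Qed.

Lemma dual_norm_ge0 (f : dual) : 0 <= dual_norm f.
Proof.
apply: (@le_trans _ _ `|f 0|) => //; apply: ub_le_sup.
  by have [] := dual_norm_has_sup f.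
by exists 0 => //=; rewrite normr0 ler01.
Qed.

Lemma dual_normD (f g : dual) : dual_norm (f + g) <= dual_norm f + dual_norm g.
Proof.
apply: dual_norm_le => x x1.
rewrite -[(f + g) x]/(f x + g x) (le_trans (ler_normD _ _))// lerD//.
  by rewrite (le_trans (le_dual_norm _ _))// ler_piMr// dual_norm_ge0.
by rewrite (le_trans (le_dual_norm _ _))// ler_piMr// dual_norm_ge0.
Qed.

Lemma dual_normZ (a : R) (f : dual) : dual_norm (a *: f) = `|a| * dual_norm f.
Proof.
have le_normZ (b : R) (g : dual) : dual_norm (b *: g) <= `|b| * dual_norm g.
  apply: dual_norm_le => x x1.
  rewrite -[(b *: g) x]/(b *: g x) normrZ ler_wpM2l//.
  by rewrite (le_trans (le_dual_norm _ _))// ler_piMr// dual_norm_ge0.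
apply/eqP; rewrite eq_le le_normZ/=.
have [->|a0] := eqVneq a 0; first by rewrite normr0 mul0r dual_norm_ge0.
rewrite -ler_pdivlMl ?normr_gt0// -normfV.
by rewrite -{1}(scalerK a0 f) le_normZ.
Qed.

Lemma dual_norm_eq0 (f : dual) : dual_norm f = 0 -> f = 0.
Proof.
move=> f0; apply/val_inj/funext => x /=.
apply/eqP; rewrite -normr_le0.
by have := le_dual_norm f x; rewrite f0 mul0r.
Qed.

HB.instance Definition _ :=
  Lmodule_isNormed.Build R dual dual_normD dual_normZ dual_norm_eq0.

Lemma dual_normE (f : dual) :
  `|f| = sup [set `|f x| | x in [set x : X | `|x| <= 1]].
Proof. by []. Qed.

Lemma dual_cauchy_cvg (F : set_system dual) :
  ProperFilter F -> cauchy F -> cvg F.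
Proof.
move=> FF /cauchy_ballP Fc.
have Fe (e : R) : 0 < e -> exists2 A : set dual, F A &
    forall (f g : dual) (x : X), A f -> A g -> `|f x - g x| <= e * `|x|.
  move=> e0; have [[A B] /= [FA FB] AB] := Fc _ e0.
  exists (A `&` B); first exact: filterI.
  move=> f g x [Af _] [_ Bg].
  have : ball f e g by exact: (AB (f, g)).
  rewrite -ball_normE /= => /ltW fge.
  rewrite -[f x - g x]/((f - g) x) (le_trans (le_dual_norm _ _))//.
  by rewrite ler_wpM2r.
have Fx (x : X) : cvg ((fun f : dual => f x) @ F).
  apply: cauchy_cvg; apply/cauchy_ballP => e e0.
  have e'0 : 0 < e / (`|x| + 1) by rewrite divr_gt0// ltr_wpDl.
  have [A FA fgA] := Fe _ e'0.
  exists ([set f x | f in A], [set f x | f in A]) => /=.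
    by split; apply: (@filterS dual F _ A) => // f Af; exists f.
  move=> [_ _] [/= [f Af <-] [g Ag <-]]; rewrite -ball_normE /=.
  rewrite (le_lt_trans (fgA _ _ _ Af Ag))// mulrAC ltr_pdivrMr ?ltr_wpDl//.
  by rewrite ltr_pM2l// ltrDl.
pose l (x : X) : R^o := lim ((fun f : dual => f x) @ F).
have lP (x : X) : (fun f : dual => f x) @ F --> l x by exact: Fx.
have ll : linear l.
  move=> a x y; apply: (@cvg_unique _ _ ((fun f : dual => f (a *: x + y)) @ F)).
  - exact: Rhausdorff.
  - exact: lP.
  have -> : (fun f : dual => f (a *: x + y)) = (fun f => a *: f x + f y).
    by apply/funext => f; exact: dual_linear.
  apply: cvgD; last exact: lP.
  by apply: cvgZl_tmp; exact: lP.
have Fl (e : R) : 0 < e ->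
    F [set f : dual | forall x, `|l x - f x| <= e * `|x|].
  move=> e0; have [A FA fgA] := Fe _ e0.
  apply: (@filterS dual F _ A) => // f Af x; apply/ler_addgt0Pr => d d0.
  have [g [Ag gd]] : exists g : dual, A g /\ `|l x - g x| <= d.
    have /cvgrPdist_le/(_ _ d0) lxd := lP x.
    by have [g [Ag gd]] := filter_ex (filterI FA lxd); exists g.
  rewrite -(subrKA (g x)) (le_trans (ler_normD _ _))// addrC lerD//.
  exact: fgA.
pose L : {linear X -> R^o} := HB.pack l (GRing.isLinear.Build _ _ _ _ l ll).
have lc : continuous l.
  suff /bounded_funP :
      forall r : R, exists M, forall x, `|x| <= r -> `|L x| <= M.
    exact: (@bounded_linear_continuous _ _ _ L).
  move=> r.
  have [f f1] := filter_ex (Fl _ (@ltr01 R)).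
  exists ((1 + `|f|) * r) => x xr /=.
  rewrite -[l x](subrK (f x)) (le_trans (ler_normD _ _))// mulrDl lerD//.
    by rewrite (le_trans (f1 x))// ler_wpM2l.
  by rewrite (le_trans (le_dual_norm _ _))// ler_wpM2l// dual_norm_ge0.
have lmem : l \in continuous_linear_form by rewrite inE.
apply/cvg_ex; exists (Dual lmem); apply/cvgrPdist_le => e e0.
apply: filterS (Fl _ e0) => f fl; apply: dual_norm_le => x x1.
rewrite -[(_ - f) x]/(l x - f x) (le_trans (fl x))//.
by rewrite ler_piMr// ltW.
Qed.

HB.instance Definition _ := Uniform_isComplete.Build dual dual_cauchy_cvg.

End DualSpace.

Arguments dual {R} X.

(* For a normed module the library's extended distance edist is the norm
   distance, so edist_inf A x is d(x, A), with value +oo when A is empty. *)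
Lemma edist_normE {R : realType} {X : normedModType R} (x y : X) :
  edist (x, y) = `|x - y|%:E.
Proof.
apply/eqP; rewrite eq_le; apply/andP; split.
  apply/lee_addgt0Pr => e e0; apply: ereal_inf_lbound => /=.
  exists (`|x - y| + e) => //; split; first by rewrite ltr_wpDl.
  by rewrite -ball_normE /= ltrDl.
apply: le_ereal_inf_tmp => _ [r [_ xyr] <-].
by rewrite lee_fin ltW//; move: xyr; rewrite -ball_normE.
Qed.

Section PropertyStar.
Context {R : realType} (X : completeNormedModType R).

Definition slice (f : dual X) (e : R) : set X :=
  [set x | `|x| <= 1 /\ f x > 1 - e].

Definition property_star : Prop :=
  forall e : R, 0 < e ->
  forall x y1 y2 : X, `|x| = 1 -> `|y1| = 1 -> `|y2| = 1 ->
  exists f : dual X, [/\ `|f| = 1, slice f e x,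
    (edist_inf (slice f e) y1 + edist_inf (-%R @` slice f e) y1
       < (2 + e)%:E)%E &
    (edist_inf (slice f e) y2 + edist_inf (-%R @` slice f e) y2
       < (2 + e)%:E)%E].

End PropertyStar.

(* Main.v *)
Require Import Defs.
From HB Require Import structures.
From mathcomp Require Import all_boot all_order all_algebra.
From mathcomp Require Import all_classical all_reals all_analysis.
From mathcomp Require Import lra.

(** Let J : X -> X** be the canonical embedding. The slice property of X**,
    applied to J x, J y1, J y2, yields a functional F on X** whose slice
    contains J x together with points u_i, v_i such that
    |J y_i - u_i| + |J y_i + v_i| is less than 2 + d. Two things have to be
    brought down to X: the functional F, and the points u_i, v_i.

    The functional: an h in the ball of X* is wanted at which the five elements
    J x, u_i, v_i of X** all exceed 1 - d. If there were none, the minimax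
    principle [convex_minimax] would give a convex combination G of the five
    elements with G h <= 1 - d for all h in the ball, so |G| <= 1 - d; but
    F G > 1 - d and |F| <= 1. This is [common_slice].

    The points: once h is fixed, each u among the u_i, v_i satisfies only three
    convex conditions, on |u|, on |u - J y| and on u h. By [bidual_reflection]
    strict inequalities of this kind are inherited by some w in X. The same
    minimax principle reduces the claim to a single function
    w |-> l1 |w| + l2 |w - y| - l3 h w, and a lower bound of that function on X
    persists on X** because it is witnessed by functionals in X*
    ([bidual_minorant]).

    Finally h is normalised, and w is divided by 1 + d so as to fall in the unit
    ball; d is chosen small enough to absorb the losses.

    Both the minimax principle and the lower bound on X** are instances of the
    Mazur-Orlicz form of the Hahn-Banach theorem, [mazur_orlicz]. *)

Set Implicit Arguments.
Unset Strict Implicit.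
Unset Printing Implicit Defensive.

Import Order.TTheory GRing.Theory Num.Theory.
Import numFieldNormedType.Exports.

Local Open Scope classical_set_scope.
Local Open Scope ring_scope.

(** * Hahn-Banach in Mazur-Orlicz form *)

Lemma le_infD {R : realType} (A B : set R) (x : R) : A !=set0 -> B !=set0 ->
  (forall a b, A a -> B b -> x <= a + b) -> x <= inf A + inf B.
Proof.
move=> A0 B0 xAB; rewrite -lerBlDr; apply: lb_le_inf => // a Aa.
rewrite lerBlDr addrC -lerBlDr; apply: lb_le_inf => // b Bb.
by rewrite lerBlDr addrC xAB.
Qed.

Section Sublinear.
Context {R : realType} {V : lmodType R}.
Implicit Types (p q : V -> R) (D : set (V * R^o)).

Definition sublinear p :=
  (forall v w, p (v + w) <= p v + p w) /\
  (forall t v, 0 <= t -> p (t *: v) <= t * p v).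

Lemma sublinear0 p : sublinear p -> p 0 = 0.
Proof.
move=> [pD pZ]; apply/eqP; rewrite eq_le; apply/andP; split.
  by have := pZ 0 0 (lexx 0); rewrite scale0r mul0r.
by have := pD 0 0; rewrite addr0; lra.
Qed.

Lemma sublinear_geN p v : sublinear p -> - p (- v) <= p v.
Proof.
move=> ps; have := ps.1 v (- v); rewrite subrr (sublinear0 ps); lra.
Qed.

Lemma sublinearZ p t v : sublinear p -> 0 <= t -> p (t *: v) = t * p v.
Proof.
move=> ps; rewrite le_eqVlt => /predU1P[<-|t0].
  by rewrite scale0r mul0r sublinear0.
apply/eqP; rewrite eq_le; apply/andP; split; first by rewrite ps.2// ltW.
rewrite -ler_pdivlMl//.
by rewrite -{1}(scalerK (lt0r_neq0 t0) v) ps.2 // ?invr_ge0 ltW.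
Qed.

Definition convex_closed (U : lmodType R) (D : set U) :=
  forall d e s t, D d -> D e -> 0 <= s -> 0 <= t -> s + t = 1 ->
    D (s *: d + t *: e).

(** The generated cone is again closed under addition: rescale by s + t. *)
Lemma convex_cone (U : lmodType R) (D : set U) d e s t : convex_closed D ->
  D d -> D e -> 0 <= s -> 0 <= t -> exists2 c, D c &
  s *: d + t *: e = (s + t) *: c.
Proof.
move=> Dc Dd De s0 t0; have [st0|st0] := eqVneq (s + t) 0.
  exists d => //; have [-> ->] : s = 0 /\ t = 0 by split; lra.
  by rewrite addr0 !scale0r addr0.
exists ((s / (s + t)) *: d + (t / (s + t)) *: e).
  by apply: Dc; rewrite ?divr_ge0 ?addr_ge0// -mulrDl divff.
by rewrite scalerDr !scalerA ![(s + t) * _]mulrC !divfK.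
Qed.

(** The functional p is the infimum of q (v + s d) - s r over all s >= 0 and all
    (d, r) in D: the largest sublinear functional below q that forces every
    linear functional below it to dominate D, as phi (- d) <= - r says
    r <= phi d. *)
Lemma sublinear_shift q D : sublinear q -> D !=set0 -> convex_closed D ->
  (forall d, D d -> d.2 <= q d.1) ->
  exists p, [/\ sublinear p, forall v, p v <= q v &
    forall d, D d -> p (- d.1) <= - d.2].
Proof.
move=> qs [d0 Dd0] Dc Dq.
pose E v := [set r | exists s d, [/\ 0 <= s, D d &
  r = q (v + s *: d.1) - s * d.2]].
have E0 v : E v !=set0 by exists (q (v + 0 *: d0.1) - 0 * d0.2), 0, d0.
have Elb v : has_lbound (E v).
  exists (- q (- v)) => _ [s [d [s0 Dd ->]]].
  have : s * d.2 <= q (s *: d.1) by rewrite sublinearZ// ler_wpM2l// Dq.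
  have := qs.1 (v + s *: d.1) (- v); rewrite addrC addKr; lra.
pose p v := inf (E v).
have pE v s d : 0 <= s -> D d -> p v <= q (v + s *: d.1) - s * d.2.
  by move=> s0 Dd; apply: ge_inf => //; exists s, d.
have pq v : p v <= q v.
  by have := pE v 0 d0 (lexx _) Dd0; rewrite scale0r mul0r addr0 subr0.
exists p; split => //.
- split=> [v w|t v].
    apply: le_infD => // _ _ [s [d [s0 Dd ->]]] [t [e [t0 De ->]]].
    have [c Cc E'] := convex_cone Dc Dd De s0 t0.
    have [E1 E2] := (congr1 fst E', congr1 snd E'); rewrite /= in E1 E2.
    have := pE (v + w) _ c (addr_ge0 s0 t0) Cc.
    rewrite -E1 -[(s + t) * _]E2 addrACA.
    have := qs.1 (v + s *: d.1) (w + t *: e.1).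
    by rewrite -![_ *: _.2]/(_ * _.2); lra.
  rewrite le_eqVlt => /predU1P[<-|t0].
    by rewrite scale0r mul0r (le_trans (pq _))// sublinear0.
  rewrite -ler_pdivrMl//; apply: lb_le_inf => // _ [s [d [s0 Dd ->]]].
  rewrite ler_pdivrMl// mulrBr -(sublinearZ _ qs (ltW t0)) scalerDr scalerA.
  rewrite mulrA.
  by apply: pE => //; rewrite mulr_ge0// ltW.
- move=> d Dd; have := pE (- d.1) 1 d ler01 Dd.
  by rewrite scale1r addNr sublinear0// mul1r sub0r.
Qed.

(** Zorn's lemma applies because the pointwise infimum of a chain of sublinear
    functionals below q is finite, being bounded below at v by - q (- v), and is
    sublinear: two members of a chain can be compared before adding. *)
Lemma sublinear_minimal q : sublinear q -> exists p, [/\ sublinear p,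
  forall v, p v <= q v &
  forall p', sublinear p' -> (forall v, p' v <= p v) -> p' = p].
Proof.
move=> qs.
pose T := {p | sublinear p /\ forall v, p v <= q v}.
pose ge (p p' : T) := `[< forall v, sval p' v <= sval p v >].
have [| | |A Atot|[p [ps pq]] pmin] := @Zorn T ge.
- by move=> p; apply/asboolP.
- move=> r s t /asboolP rs /asboolP st; apply/asboolP => v.
  exact: le_trans (st v) (rs v).
- move=> [s Ps] [t Pt] /asboolP/= st /asboolP/= ts.
  apply: eq_exist; apply/funext => v.
  by apply/eqP; rewrite eq_le st ts.
- have [A0|] := eqVneq A set0.
    by exists (exist _ q (conj qs (fun=> lexx _))) => s; rewrite A0.
  move=> /set0P[a0 Aa0].
  pose E v := [set sval s v | s in A].
  have E0 v : E v !=set0 by exists (sval a0 v), a0.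
  have Elb v : has_lbound (E v).
    exists (- q (- v)) => _ [[s [ss sq]] As <-] /=.
    by rewrite (le_trans _ (sublinear_geN _ ss))// lerN2.
  have EP v s : A s -> inf (E v) <= sval s v.
    by move=> As; apply: ge_inf => //; exists s.
  have ms : sublinear (fun v => inf (E v)).
    split=> [v w|t v].
      apply: le_infD => // _ _ [s As <-] [s' As' <-].
      case: (Atot _ _ As As') => /asboolP ss'.
        rewrite (le_trans (EP _ _ As'))// (le_trans ((svalP s').1.1 _ _))//.
        by rewrite lerD.
      rewrite (le_trans (EP _ _ As))// (le_trans ((svalP s).1.1 _ _))//.
      by rewrite lerD.
    rewrite le_eqVlt => /predU1P[<-|t0].
      rewrite scale0r mul0r (le_trans (EP _ _ Aa0))// sublinear0//.
      by case: (svalP a0).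
    rewrite -ler_pdivrMl//; apply: lb_le_inf => // _ [s As <-].
    by rewrite ler_pdivrMl// (le_trans (EP _ _ As))// (svalP s).1.2// ltW.
  have mq v : inf (E v) <= q v.
    by rewrite (le_trans (EP _ _ Aa0))// (svalP a0).2.
  exists (exist _ (fun v => inf (E v)) (conj ms mq)) => s As.
  by apply/asboolP => v /=; exact: EP.
- exists p; split => // p' p's p'p.
  have p'q v : p' v <= q v := le_trans (p'p v) (pq v).
  suff /(congr1 sval) : exist _ p' (conj p's p'q) =
      exist _ p (conj ps pq) :> T by [].
  by apply: pmin; apply/asboolP.
Qed.

(** A minimal sublinear functional is linear: shifting it along the single pair
    (v, p v) cannot make it smaller, and this says p (- v) <= - p v. Taking a
    minimal functional below the one shifted along D gives the result. With
    D = {(v, q v)} this is the Hahn-Banach theorem at v; for general D it also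
    separates convex sets. *)
Theorem mazur_orlicz q D : sublinear q -> D !=set0 -> convex_closed D ->
  (forall d, D d -> d.2 <= q d.1) ->
  exists phi : {linear V -> R^o},
    (forall v, phi v <= q v) /\ (forall d, D d -> d.2 <= phi d.1).
Proof.
move=> qs D0 Dc Dq.
have [q' [q's q'q q'D]] := sublinear_shift qs D0 Dc Dq.
have [p [ps pq' pmin]] := sublinear_minimal q's.
have pN v : p (- v) = - p v.
  apply/eqP; rewrite eq_le; apply/andP; split; last first.
    by have := sublinear_geN (- v) ps; rewrite opprK.
  have [||_ -> //|p' [p's p'p p'v]] := @sublinear_shift p [set (v, p v)] ps.
  - by exists (v, p v).
  - move=> _ _ s t -> -> _ _ st.
    by rewrite -scalerDl st scale1r.
  have := p'v _ erefl; rewrite /=.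
  by rewrite (pmin _ p's p'p).
have pD v w : p (v + w) = p v + p w.
  apply/eqP; rewrite eq_le ps.1/=.
  by have := ps.1 (- v) (- w); rewrite -opprD !pN; lra.
have plin : linear (p : V -> R^o).
  move=> t v w; rewrite pD; congr (_ + _).
  have [t0|t0] := leP 0 t; first by rewrite sublinearZ.
  have -> : t *: v = - ((- t) *: v) by rewrite scaleNr opprK.
  by rewrite pN sublinearZ ?oppr_ge0 ?ltW// mulNr opprK.
pose phi : {linear V -> R^o} := HB.pack p (GRing.isLinear.Build _ _ _ _ p plin).
exists phi; split => [v|d Dd]; first exact: le_trans (pq' v) (q'q v).
have := le_trans (pq' _) (q'D d Dd).
by rewrite pN lerN2.
Qed.

End Sublinear.

(** * A minimax principle for finitely many convex functions *)

Lemma convex_combination_lt0 {R : realDomainType} (I : finType) (l a : I -> R) :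
  (forall i, 0 <= l i) -> \sum_i l i = 1 -> (forall i, a i < 0) ->
  \sum_i l i * a i < 0.
Proof.
move=> l0 l1 a0; rewrite ltNge; apply/negP => la0.
have la_ge0 i : true -> 0 <= l i * - a i.
  by move=> _; rewrite mulr_ge0// oppr_ge0 ltW.
have la_eq0 : \sum_i l i * - a i = 0.
  apply/eqP; rewrite eq_le sumr_ge0 ?andbT//.
  by under eq_bigr do rewrite mulrN; rewrite sumrN oppr_le0.
have : \sum_i l i = 0.
  apply: big1 => i _; have /eqP := psumr_eq0P la_ge0 la_eq0 (i := i) isT.
  by rewrite mulf_eq0 oppr_eq0 (lt_eqF (a0 i)) orbF => /eqP.
by rewrite l1 => /eqP; rewrite oner_eq0.
Qed.

(** If no point of W makes all g_i negative, the convex set of vectors t that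
    dominate some (g_i w)_i lies where max_i t_i >= 0. A linear functional below
    the maximum is a convex combination of the coordinates, and mazur_orlicz
    provides one that is nonnegative on this set. *)
Lemma convex_minimax {R : realType} (I : finType) (V : lmodType R) (W : set V)
    (g : I -> V -> R) :
  W !=set0 -> convex_closed W ->
  (forall i v w s t, W v -> W w -> 0 <= s -> 0 <= t -> s + t = 1 ->
    g i (s *: v + t *: w) <= s * g i v + t * g i w) ->
  (forall l : I -> R, (forall i, 0 <= l i) -> \sum_i l i = 1 ->
    exists2 w, W w & \sum_i l i * g i w < 0) ->
  exists2 w, W w & forall i, g i w < 0.
Proof.
move=> [w0 Ww0] Wc gc lg; apply: contrapT => /forall2NP Wg.
have {}Wg w : W w -> exists i, 0 <= g i w.
  move=> Ww; have [//|/existsNP[i /negP]] := Wg w.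
  by rewrite -leNgt; exists i.
have [i0 _] := Wg _ Ww0.
pose q (t : I -> R^o) : R := \big[Num.max/t i0]_i t i.
have qle t M : (forall i, t i <= M) -> q t <= M by move=> tM; exact: bigmax_le.
have leq t i : t i <= q t by exact: le_bigmax.
have qs : sublinear q.
  split=> [v w|t v t0]; apply: qle => i; first by rewrite lerD.
  by rewrite ler_wpM2l.
pose D : set ((I -> R^o) * R^o) :=
  [set d | d.2 = 0 /\ exists2 w, W w & forall i, g i w <= d.1 i].
have [||d [-> [w Ww gd]]|phi [phiq phiD]] := @mazur_orlicz _ _ q D qs.
- by exists (fun i => g i w0, 0); split => //; exists w0.
- move=> d e s t [d2 [w Ww gd]] [e2 [z Wz ge]] s0 t0 st; split => /=.
    by rewrite d2 e2 !scaler0 addr0.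
  exists (s *: w + t *: z); first exact: Wc.
  move=> i; rewrite (le_trans (gc _ _ _ _ _ Ww Wz s0 t0 st))//.
  by rewrite lerD// ler_wpM2l.
- have [i gi] := Wg _ Ww.
  by rewrite (le_trans gi)// (le_trans (gd i)).
pose delta (i : I) : I -> R^o := fun j => (i == j)%:R.
have phiE t : phi t = \sum_i phi (delta i) * t i.
  have {1}-> : t = \sum_i t i *: delta i.
    have deltaE i j : (t i *: delta i) j = t i * (i == j)%:R by [].
    apply/funext => j; rewrite fct_sumE (bigD1 j)//= big1 => [|i ij].
      by rewrite addr0 deltaE eqxx mulr1.
    by rewrite deltaE (negbTE ij) mulr0.
  by rewrite linear_sum; apply: eq_bigr => i _; rewrite linearZ/= mulrC.
have phiN t M : (forall i, - t i <= M) -> - phi t <= M.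
  by move=> tM; rewrite -linearN (le_trans (phiq _))// qle.
have [||w Ww] := lg (fun i => phi (delta i)).
- by move=> i; rewrite -oppr_le0; apply: phiN => j; rewrite oppr_le0 ler0n.
- have -> : \sum_i phi (delta i) = phi (fun=> 1).
    by rewrite phiE; apply: eq_bigr => i _; rewrite mulr1.
  apply/eqP; rewrite eq_le; apply/andP; split.
    by rewrite (le_trans (phiq _))// qle.
  by rewrite -lerN2; apply: phiN.
- rewrite -phiE ltNge => /negP; apply.
  by apply: (phiD (fun i => g i w, 0)); split => //; exists w.
Qed.

(** * The dual and the canonical embedding into the bidual *)

Section Dual.
Context {R : realType} {X : normedModType R}.
Implicit Types (x y w : X) (f h : dual X).

Lemma dual_sumE (I : finType) (l : I -> R) (e : I -> dual X) x :
  (\sum_i l i *: e i) x = \sum_i l i * e i x.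
Proof.
exact: (big_morph (fun f : dual X => f x) (fun f g => erefl) erefl).
Qed.

(** A one-sided bound suffices, by applying it to - x; this is the form in which
    the bounds come out of mazur_orlicz. *)
Lemma bounded_form_dual (phi : {linear X -> R^o}) (M : R) :
  (forall x, phi x <= M * `|x|) -> (phi : X -> R^o) \in continuous_linear_form.
Proof.
move=> phiM; rewrite inE; split; first exact: linearP.
apply: bounded_linear_continuous; apply/bounded_funP => r.
exists (`|M| * `|r|) => x xr.
apply: (@le_trans _ _ (M * `|x|)).
  by rewrite ler_norml phiM lerNl -linearN -(normrN x) phiM.
rewrite (le_trans (ler_norm _))// normrM normr_id ler_wpM2l//.
by rewrite (le_trans xr)// ler_norm.
Qed.

Lemma norming_form x : exists2 f : dual X, `|f| <= 1 & f x = `|x|.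
Proof.
have ns : sublinear (fun v : X => `|v|).
  split=> [v w|t v t0]; first exact: ler_normD.
  by rewrite normrZ ger0_norm.
have [||d -> //|phi [phin phix]] :=
  @mazur_orlicz _ _ _ [set (x, `|x| : R^o)] ns.
- by exists (x, `|x|).
- by move=> _ _ s t -> -> _ _ st; rewrite -scalerDl st scale1r.
have phi1 v : phi v <= 1 * `|v| by rewrite mul1r.
exists (Dual (bounded_form_dual phi1)).
  apply: dual_norm_le => v v1 /=.
  by rewrite ler_norml lerNl -linearN !(le_trans (phin _)) ?normrN.
by apply/eqP; rewrite eq_le phin/=; exact: (phix (x, _) erefl).
Qed.

End Dual.

Section Bidual.
Context {R : realType} {X : normedModType R}.
Implicit Types (x y w : X) (f h : dual X).

Definition evaluation x (f : dual X) : R^o := f x.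

Lemma evaluation_linear x : linear (evaluation x).
Proof. by []. Qed.

HB.instance Definition _ x :=
  GRing.isLinear.Build R (dual X) R^o *:%R (evaluation x) (evaluation_linear x).

Lemma evaluation_le x f : evaluation x f <= `|x| * `|f|.
Proof. by rewrite (le_trans (ler_norm _))// mulrC le_dual_norm. Qed.

Definition bidual_embedding x : dual (dual X) :=
  Dual (bounded_form_dual (evaluation_le x)).

Local Notation J := bidual_embedding.

Lemma bidual_embedding_norm x : `|J x| = `|x|.
Proof.
apply/eqP; rewrite eq_le; apply/andP; split.
  apply: dual_norm_le => f f1; rewrite -[J x f]/(f x).
  by rewrite (le_trans (le_dual_norm _ _))// ler_piMl.
have [f f1 <-] := norming_form x.
rewrite (le_trans (ler_norm _))// (le_trans (le_dual_norm (J x) f))//.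
by rewrite ler_piMr// dual_norm_ge0.
Qed.

(** * Transfer from the bidual to the space *)

(** Helly's condition for a finite system of inequalities: by minimax it is
    enough to exceed c with each convex combination of the e_i somewhere in the
    ball, that is to see that its norm exceeds c, and F bears witness to
    that. *)
Lemma common_slice (I : finType) (e : I -> dual X) (F : dual (dual X)) (c : R) :
  `|F| <= 1 -> (forall i, c < F (e i)) ->
  exists2 x, `|x| <= 1 & forall i, c < e i x.
Proof.
move=> F1 Fe.
pose W := [set x : X | `|x| <= 1].
have [|||l l0 l1|x x1 ex] := @convex_minimax _ I _ W (fun i x => c - e i x).
- by exists 0; rewrite /W/= normr0 ler01.
- move=> x y s t; rewrite /W/= => x1 y1 s0 t0 st.
  rewrite (le_trans (ler_normD _ _))// !normrZ !ger0_norm// -st.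
  by rewrite lerD// ler_piMr.
- move=> i x y s t _ _ s0 t0 st; rewrite linearD !linearZ/=.
  rewrite -![_ *: e i _]/(_ * e i _).
  have : s * c + t * c = c by rewrite -mulrDl st mul1r.
  by lra.
- apply: contrapT => /forall2NP nW.
  pose G : dual X := \sum_i l i *: e i.
  have GM x : `|x| <= 1 -> G x <= c.
    move=> x1; have [//|/negP] := nW x; rewrite -leNgt.
    under eq_bigr do rewrite mulrBr.
    by rewrite sumrB -mulr_suml l1 mul1r -dual_sumE subr_ge0.
  have Gc : `|G| <= c.
    apply: dual_norm_le => x x1.
    by rewrite ler_norml GM// lerNl -linearN GM// normrN.
  have FG : F G <= c.
    rewrite (le_trans (ler_norm _))// (le_trans (le_dual_norm _ _))//.
    by rewrite (le_trans _ Gc)// ler_piMl.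
  have : \sum_i l i * (c - F (e i)) < 0.
    by apply: convex_combination_lt0 => // i; rewrite subr_lt0.
  under eq_bigr do rewrite mulrBr.
  rewrite sumrB -mulr_suml l1 mul1r subr_lt0 ltNge => /negP; apply.
  move: FG; rewrite linear_sum.
  by under eq_bigr do rewrite linearZ.
- by exists x => // i; have := ex i; rewrite subr_lt0.
Qed.

(** The lower bound m on X says that w |-> m + h w - l2 |w - y|, a concave
    function, lies below the sublinear l1 |w|. A linear f in between splits h as
    f + g with |f| <= l1 and g w <= l2 |w - y| - m, hence |g| <= l2 and
    g y <= - m. Evaluating u at h = f + g gives the bound on the bidual. *)
Lemma bidual_minorant h y (l1 l2 m : R) : 0 <= l1 -> 0 <= l2 ->
  (forall w, m <= l1 * `|w| + l2 * `|w - y| - h w) ->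
  forall u : dual (dual X), m <= l1 * `|u| + l2 * `|u - J y| - u h.
Proof.
move=> l10 l20 mle u.
have qs : sublinear (fun w : X => l1 * `|w|).
  split=> [v w|t v t0]; first by rewrite -mulrDr ler_wpM2l// ler_normD.
  by rewrite normrZ ger0_norm// mulrCA.
pose D : set (X * R^o) := [set d | d.2 <= m + h d.1 - l2 * `|d.1 - y|].
have [||[w r]|phi [phiq phiD]] := @mazur_orlicz _ _ _ D qs.
- by exists (y, m + h y - l2 * `|y - y|); rewrite /D/=.
- move=> [v a] [w b] s t; rewrite /D/= => va wb s0 t0 st.
  have E : s *: v + t *: w - y = s *: (v - y) + t *: (w - y).
    by rewrite !scalerBr addrACA -opprD -scalerDl st scale1r.
  have := ler_normD (s *: (v - y)) (t *: (w - y)).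
  rewrite -E !normrZ !ger0_norm// => /(ler_wpM2l l20).
  have -> : h (s *: v + t *: w) = s * h v + t * h w.
    by rewrite linearD !linearZ.
  have := ler_wpM2l s0 va; have := ler_wpM2l t0 wb.
  rewrite -[_ *: a]/(_ * a) -[_ *: b]/(_ * b).
  move=> H1 H2 H3.
  have : s * m + t * m = m by rewrite -mulrDl st mul1r.
  lra.
- by rewrite /D/= => H; have := mle w; lra.
pose f : dual X := Dual (bounded_form_dual phiq).
have fn : `|f| <= l1.
  apply: dual_norm_le => v v1.
  rewrite (@le_trans _ _ (l1 * `|v|)) ?ler_piMr//.
  by rewrite ler_norml lerNl -linearN -{1}(normrN v) !phiq.
pose g : dual X := h - f.
have gm w : g w <= l2 * `|w - y| - m.
  have := phiD (w, m + h w - l2 * `|w - y|) (lexx _).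
  by rewrite -[g w]/(h w - phi w) /=; lra.
have gn : `|g| <= l2.
  have gle v : g v <= l2 * `|v|.
    (* A bound on t (g v) that is affine in t is homogeneous in the limit of
       large t; the constant k is absorbed by e once t = (|k| + 1) / e. *)
    apply/ler_addgt0Pr => e e0.
    pose k := g y + m.
    have H t : 0 < t -> t * g v <= t * (l2 * `|v|) - k.
      move=> t0; have := gm (t *: v + y).
      rewrite addrK normrZ gtr0_norm// linearD linearZ/= -[_ *: g v]/(_ * g v).
      by rewrite /k; lra.
    have t0 : 0 < (`|k| + 1) / e by rewrite divr_gt0// ltr_wpDl.
    have te : (`|k| + 1) / e * e = `|k| + 1 by rewrite divfK// gt_eqF.
    rewrite -(ler_pM2l t0) (le_trans (H _ t0))//.
    rewrite [leRHS]mulrDr te lerD2l.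
    by rewrite (le_trans (ler_norm _))// normrN lerDl.
  apply: dual_norm_le => v v1.
  rewrite (@le_trans _ _ (l2 * `|v|)) ?ler_piMr//.
  by rewrite ler_norml lerNl -linearN -{1}(normrN v) !gle.
have uhE : u h = u f + (u - J y) g + g y.
  rewrite -[(u - J y) g]/(u g - g y) -addrA subrK -linearD /g.
  by rewrite addrC subrK.
have uf : u f <= l1 * `|u|.
  rewrite (le_trans (ler_norm _))// (le_trans (le_dual_norm _ _))// mulrC.
  by rewrite ler_wpM2r// dual_norm_ge0.
have ug : (u - J y) g <= l2 * `|u - J y|.
  rewrite (le_trans (ler_norm _))// (le_trans (le_dual_norm _ _))// mulrC.
  by rewrite ler_wpM2r// dual_norm_ge0.
have := gm y; rewrite subrr normr0 mulr0; lra.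
Qed.

(** By minimax and bidual_minorant, a nonnegative combination of the convex
    functions |w| - r, |w - y| - a and c - h w that is nonnegative on the whole
    of X is so on the bidual, whereas all three are negative at u. *)
Lemma bidual_reflection h y (u : dual (dual X)) (r a c : R) :
  `|u| < r -> `|u - J y| < a -> c < u h ->
  exists w, [/\ `|w| < r, `|w - y| < a & c < h w].
Proof.
move=> ur ua uc.
pose g (i : 'I_3) w := [:: `|w| - r; `|w - y| - a; c - h w]`_i.
have [|//||l l0 l1|w _ gw] := @convex_minimax _ 'I_3 X setT g.
- by exists 0.
- move=> i v w s t _ _ s0 t0 st.
  have C (z : X) (b : R) : `|s *: v + t *: w - z| - b <=
      s * (`|v - z| - b) + t * (`|w - z| - b).
    have -> : s *: v + t *: w - z = s *: (v - z) + t *: (w - z).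
      by rewrite !scalerBr addrACA -opprD -scalerDl st scale1r.
    have := ler_normD (s *: (v - z)) (t *: (w - z)).
    rewrite !normrZ !ger0_norm//.
    have : s * b + t * b = b by rewrite -mulrDl st mul1r.
    by lra.
  rewrite /g; case: i => -[|[|[|//]]] ? /=.
  + by have := C 0 r; rewrite !subr0.
  + exact: C.
  + rewrite linearD !linearZ/= -![_ *: h _]/(_ * h _).
    have : s * c + t * c = c by rewrite -mulrDl st mul1r.
    by lra.
- apply: contrapT => /forall2NP nW.
  pose i1 : 'I_3 := lift ord0 ord0.
  pose i2 : 'I_3 := lift ord0 (lift ord0 ord0).
  have mle w : l ord0 * r + l i1 * a - l i2 * c <=
      l ord0 * `|w| + l i1 * `|w - y| - (l i2 *: h) w.
    have [/(_ I)//|/negP] := nW w; rewrite -leNgt -[(_ *: h) w]/(_ * h w).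
    by rewrite !big_ord_recl big_ord0 /g /=; lra.
  have := bidual_minorant (l0 _) (l0 _) mle u.
  have -> : u (l i2 *: h) = l i2 * u h by rewrite linearZ.
  have := @convex_combination_lt0 _ _ l
    (fun i => [:: `|u| - r; `|u - J y| - a; c - u h]`_i) l0 l1.
  rewrite !big_ord_recl big_ord0 /= => H.
  have : forall i : 'I_3, [:: `|u| - r; `|u - J y| - a; c - u h]`_i < 0.
    by case=> -[|[|[|//]]] ? /=; rewrite subr_lt0.
  by move/H; rewrite /i2 /i1; lra.
- exists w; split.
  + by have := gw ord0; rewrite subr_lt0.
  + by have := gw (lift ord0 ord0); rewrite subr_lt0.
  + by have := gw (lift ord0 (lift ord0 ord0)); rewrite subr_lt0.
Qed.

End Bidual.

Local Notation J := bidual_embedding.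

(** * The slice property descends *)

Lemma edist_inf_add_ltP {R : realType} {X : normedModType R} (A B : set X)
    (y : X) (r : R) :
  (edist_inf A y + edist_inf B y < r%:E)%E <->
  exists u v, [/\ A u, B v & `|y - u| + `|y - v| < r].
Proof.
split=> [|[u [v [Au Bv yuv]]]]; last first.
  apply: (@le_lt_trans _ _ (`|y - u|%:E + `|y - v|%:E)%E); last first.
    by rewrite -EFinD lte_fin.
  by apply: leeD; apply: ereal_inf_lbound; [exists u|exists v];
    rewrite // edist_normE.
have A0 := edist_inf_ge0 A y; have B0 := edist_inf_ge0 B y.
have Aad e : 0 < e -> _ :=
  @lb_ereal_inf_adherent R [set edist (y, a) | a in A] e.
have Bad e : 0 < e -> _ :=
  @lb_ereal_inf_adherent R [set edist (y, a) | a in B] e.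
rewrite /edist_inf in A0 B0 *.
case: ereal_inf A0 Aad => [a||] // _ Aad;
  case: ereal_inf B0 Bad => [b||] // _ Bad.
rewrite -EFinD lte_fin => abr.
have e0 : 0 < (r - (a + b)) / 2 by lra.
have [_ [u Au <-]] := Aad _ e0 isT.
have [_ [v Bv <-]] := Bad _ e0 isT.
rewrite !edist_normE -!EFinD !lte_fin => yv yu.
by exists u, v; split => //; lra.
Qed.

Lemma bidual_embeddingN {R : realType} {X : normedModType R} (y : X) :
  J (- y) = - J y.
Proof. by apply/val_inj/funext => f; rewrite -[RHS]/(- f y) -linearN. Qed.

(** The point given by bidual_reflection may have norm up to 1 + e; dividing it
    by 1 + e moves it by at most e. *)
Lemma bidual_reflection_ball {R : realType} {X : normedModType R} (h : dual X)
    (y : X) (u : dual (dual X)) (e : R) : 0 < e < 1 -> `|u| <= 1 ->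
  1 - e < u h ->
  exists w, [/\ `|w| <= 1, 1 - 2 * e < h w & `|y - w| < `|J y - u| + 2 * e].
Proof.
move=> /andP[e0 e1] u1 uh.
have [|||w [w1 wy wh]] := @bidual_reflection _ _ h y u (1 + e)
  (`|J y - u| + e) (1 - e).
- by rewrite (le_lt_trans u1)// ltrDl.
- by rewrite distrC ltrDl.
- by [].
have e1_gt0 : 0 < 1 + e by lra.
pose s := (1 + e)^-1.
have s0 : 0 < s by rewrite invr_gt0.
have sE : s * (1 + e) = 1 by rewrite mulVf// gt_eqF.
exists (s *: w); split.
- by rewrite normrZ gtr0_norm// -sE ler_wpM2l// ltW.
- have -> : h (s *: w) = s * h w by rewrite linearZ.
  have : s * (1 - e) < s * h w by rewrite ltr_pM2l.
  by nra.
- have -> : y - s *: w = (y - w) + (1 - s) *: w.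
    by rewrite scalerBl scale1r addrA subrK.
  rewrite (le_lt_trans (ler_normD _ _))// normrZ ger0_norm; last by nra.
  have : (1 - s) * `|w| <= (1 - s) * (1 + e) by rewrite ler_wpM2l ?ltW//; nra.
  by rewrite distrC in wy; nra.
Qed.

Theorem theorem2p7 (R : realType) (X : completeNormedModType R) :
  property_star (dual (dual X)) -> property_star X.
Proof.
move=> star e e0 x y1 y2 x1 y1n y2n.
(* Each of the two distances loses at most 2 d, so that the sum stays below
   2 + 5 d; d < 1 is needed to reflect points into the unit ball. *)
pose d := Num.min e 1 / 8.
have d0 : 0 < d by rewrite divr_gt0// lt_min e0 ltr01.
have de : d <= e / 8 by rewrite ler_pM2r// ge_min lexx.
have d1 : d <= 1 / 8 by rewrite ler_pM2r// ge_min lexx orbT.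
have [|||F [F1 [_ Fx] Fy1 Fy2]] := star d d0 (J x) (J y1) (J y2).
- by rewrite bidual_embedding_norm.
- by rewrite bidual_embedding_norm.
- by rewrite bidual_embedding_norm.
have [u1 [_ [[u1n Fu1] [v1 [v1n Fv1] <-] uv1]]] :=
  (edist_inf_add_ltP _ _ _ _).1 Fy1.
have [u2 [_ [[u2n Fu2] [v2 [v2n Fv2] <-] uv2]]] :=
  (edist_inf_add_ltP _ _ _ _).1 Fy2.
have [||h h1 hs] := @common_slice R (dual X) 'I_5
  (fun i => [:: J x; u1; v1; u2; v2]`_i) F (1 - d).
- by rewrite F1.
- by case=> -[|[|[|[|[|//]]]]].
have hx : 1 - d < h x := hs ord0.
have hn : 0 < `|h|.
  rewrite (@lt_le_trans _ _ (h x))//; first by lra.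
  by rewrite (le_trans (ler_norm _))// (le_trans (le_dual_norm _ _))// x1 mulr1.
pose f := `|h|^-1 *: h.
(* Since |h| <= 1, normalising h can only raise its nonnegative values. *)
have fge w : 0 <= h w -> h w <= f w.
  move=> hw; rewrite -[f w]/(`|h|^-1 * h w) ler_peMl// invf_ge1//.
have fS w : `|w| <= 1 -> 1 - 2 * d < h w -> slice f e w.
  move=> wn hw; split => //.
  by rewrite (lt_le_trans _ (fge w _)); lra.
have pair y (u v : dual (dual X)) :
    `|u| <= 1 -> 1 - d < u h -> `|v| <= 1 -> 1 - d < v h ->
    `|J y - u| + `|J y - - v| < 2 + d ->
    (edist_inf (slice f e) y + edist_inf (-%R @` slice f e) y < (2 + e)%:E)%E.
  move=> un hu vn hv uv; apply/edist_inf_add_ltP.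
  have d01 : 0 < d < 1 by lra.
  have [w [wn hw yw]] := bidual_reflection_ball y d01 un hu.
  have [z [zn hz yz]] := bidual_reflection_ball (- y) d01 vn hv.
  exists w, (- z); split; [exact: fS|by exists z => //; exact: fS|].
  have yzE : `|- y - z| = `|y - - z| by rewrite -opprD normrN opprK.
  have yvE : `|J (- y) - v| = `|J y - - v|.
    by rewrite bidual_embeddingN -opprD normrN opprK.
  by rewrite yzE yvE in yz; lra.
exists f; split.
- by rewrite normrZ normfV normr_id mulVf// gt_eqF.
- by apply: fS; rewrite ?x1//; lra.
- apply: (pair y1 u1 v1) => //.
  + exact: (hs (@Ordinal 5 1 isT)).
  + exact: (hs (@Ordinal 5 2 isT)).
- apply: (pair y2 u2 v2) => //.
  + exact: (hs (@Ordinal 5 3 isT)).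
  + exact: (hs (@Ordinal 5 4 isT)).
Qed.
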